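(* Let $X$ be a finite set and let $\sigma:2^{X}\rightarrow\{-1,1\}$ be an even map, i.e. $\sigma(X\setminus A)=\sigma(A)$ for all $A\subseteq X$. Let $u,v\in X$ with $u\neq v$. Then $$N_{\sigma}(u,v)=\frac14\sum_{A\subseteq X}\sigma(A),$$ and thus in particular $N_{\sigma}(u,v)$ does not depend on the choice of the distinct elements $u$ and $v$ of $X$.
   Context: $2^X$ denotes the set of all subsets of $X$. For $A\subseteq X$ and $v\in X$, write $A+v:=A\cup\{v\}$. For a map $\sigma:2^X\to\{-1,1\}$ and $u,v\in X$ with $u\ne v$, define $$N_{\sigma}(u,v):=\sum_{\substack{A\subseteq X,\ u\in A,\ v\notin A\\ \sigma(A)=\sigma(A+v)}}\sigma(A),$$ the sum being over all subsets $A$ of $X$ such that $u\in A$, $v\notin A$ and $\sigma(A)=\sigma(A+v)$. *)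

(* Defs.v *)
From mathcomp Require Import all_boot all_order all_algebra.

Set Implicit Arguments.
Unset Strict Implicit.
Unset Printing Implicit Defensive.

Import GRing.Theory Num.Theory.
Local Open Scope ring_scope.

Definition sign_map (X : finType) (sigma : {set X} -> int) : Prop :=
  forall A : {set X}, sigma A = -1 \/ sigma A = 1.

Definition even_map (X : finType) (sigma : {set X} -> int) : Prop :=
  forall A : {set X}, sigma (~: A) = sigma A.

Definition Nsigma (X : finType) (sigma : {set X} -> int) (u v : X) : int :=
  \sum_(A : {set X} | [&& u \in A, v \notin A & sigma A == sigma (v |: A)])
    sigma A.

(* Main.v *)
Require Import Defs.
From mathcomp Require Import all_boot all_order all_algebra.

(** For two signs [s] and [t], the number equal to [s] if [s = t] and to [0]
    otherwise is [(s + t) / 2]. Doubling [Nsigma sigma u v] therefore removes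
    the condition [sigma A = sigma (A + v)] and leaves the sum of
    [sigma A + sigma (A + v)] over the sets [A] that contain [u] but not [v].
    The sets [A] and [A + v] together run once over all sets containing [u],
    so that [v] disappears ([double_Nsigma]). Complementation exchanges the
    sets containing [u] with those avoiding it, and [sigma] is even, so the
    sets containing [u] carry exactly half of the total sum
    ([double_sum_mem]). Hence four times [Nsigma sigma u v] is the total. *)

Set Implicit Arguments.
Unset Strict Implicit.
Unset Printing Implicit Defensive.

Import GRing.Theory Num.Theory.
Local Open Scope ring_scope.

(** Adding [v] is a bijection from the sets avoiding [v] to the sets
    containing it, with inverse the removal of [v]; it does not affect
    membership of another element [u]. *)
Lemma sum_mem_setU1 (X : finType) (f : {set X} -> int) (u v : X) :
  u != v ->
  \sum_(A : {set X} | (u \in A) && (v \in A)) f A =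
  \sum_(A : {set X} | (u \in A) && (v \notin A)) f (v |: A).
Proof.
move=> neq_uv.
rewrite (reindex_onto (fun A => v |: A) (fun A => A :\ v)) /=; last first.
  by move=> A /andP[_ vA]; rewrite setD1K.
apply: eq_bigl => A; rewrite !inE eqxx (negPf neq_uv) /= andbT.
congr (_ && _); apply/eqP/idP => [<-|vA]; first by rewrite !inE eqxx.
by rewrite setU1K.
Qed.

Lemma double_Nsigma (X : finType) (sigma : {set X} -> int) (u v : X) :
  sign_map sigma -> u != v ->
  Nsigma sigma u v *+ 2 = \sum_(A : {set X} | u \in A) sigma A.
Proof.
move=> sigma_sign neq_uv.
rewrite [RHS](bigID (fun A : {set X} => v \in A)) /= sum_mem_setU1 //.
rewrite -big_split /= /Nsigma.
under [X in X *+ _]eq_bigl do rewrite andbA.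
rewrite big_mkcondr -sumrMnl; apply: eq_bigr => A _.
by case: (sigma_sign A) => ->; case: (sigma_sign (v |: A)) => ->.
Qed.

Lemma double_sum_mem (X : finType) (sigma : {set X} -> int) (u : X) :
  even_map sigma ->
  (\sum_(A : {set X} | u \in A) sigma A) *+ 2 = \sum_(A : {set X}) sigma A.
Proof.
move=> sigma_even; rewrite [RHS](bigID (fun A : {set X} => u \in A)) /= mulr2n.
congr (_ + _); rewrite (reindex_inj (@setC_inj X)) /=.
by apply: eq_big => A; rewrite ?inE.
Qed.

Theorem theorem1 (X : finType) (sigma : {set X} -> int)
    (sigma_sign : sign_map sigma) (sigma_even : even_map sigma) :
  (forall u v : X, u <> v ->
     (Nsigma sigma u v)%:~R
       = 1 / 4 * (\sum_(A : {set X}) sigma A)%:~R :> rat) /\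
  (forall u v u' v' : X, u <> v -> u' <> v' ->
     Nsigma sigma u v = Nsigma sigma u' v').
Proof.
have quarter u v : u <> v ->
    (Nsigma sigma u v)%:~R = 1 / 4 * (\sum_(A : {set X}) sigma A)%:~R :> rat.
  move=> /eqP neq_uv; rewrite -(double_sum_mem u sigma_even).
  rewrite -(double_Nsigma sigma_sign neq_uv) -mulrnA rmorphMn /= -[in RHS](mulr_natl _%:~R).
  by rewrite mulrA mul1r mulVf ?mul1r.
split=> // u v u' v' /quarter Nuv /quarter Nuv'.
by apply: (@intr_inj rat); rewrite Nuv Nuv'.
Qed.
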